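(* Let $X$ be a finite dimensional normed space, $A$ a closed set, $f$ l.s.c. on $\Omega$, and $\varphi$ l.s.c. on $A \times \{ p_0 \}$. Suppose that there exists a non-decreasing function $\omega \colon \mathbb{R}_+ \to \mathbb{R}_+$ such that $\omega(t) = 0$ iff $t = 0$, and $$\varphi(x, p) \ge \omega(d(p, p_0)) \quad \forall (x, p) \in A \times P.$$ Suppose also that one of the following holds: (1) there exists $\delta > 0$ such that the projection of $\Omega_{\delta}$ onto $X$ is bounded; (2) there exists $\mu > 0$ such that the set $\{ x \in A \mid \inf_{p \in P} F_{\mu}(x, p) < f^* \}$ is bounded. Then the parametric penalty function $F_{\lambda}$ is (globally) exact if and only if $F_{\lambda}$ is exact at every globally optimal solution of the problem $(\mathcal{P})$ and there exists $\lambda_0 \ge 0$ such that $F_{\lambda_0}$ is bounded below on $A \times P$.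
   Context: Setting. $M, A \subset X$ are nonempty, $f \colon X \to \mathbb{R} \cup \{+\infty\}$ with $\operatorname{dom} f = \{x : |f(x)| < +\infty\} \ne \emptyset$. The problem $(\mathcal{P})$ is: minimize $f(x)$ subject to $x \in M$, $x \in A$. Put $\Omega = M \cap A$; it is assumed that $f$ attains a global minimum on $\Omega$, with finite value $f^* = \min_{x\in\Omega} f(x)$. $P$ is a metric space, $p_0 \in P$ is fixed, and $\varphi \colon X \times P \to [0, +\infty]$ satisfies $\varphi(x, p) = 0$ iff $p = p_0$ and $x \in M$. The parametric penalty function is $F_{\lambda}(x, p) = f(x) + \lambda \varphi(x, p)$, $\lambda \ge 0$. For $\delta > 0$, $\Omega_{\delta} = \{ (x, p) \in A \times P \mid \varphi(x, p) < \delta \}$. $\mathbb{R}_+ = [0, +\infty)$. Global exactness: $F_\lambda$ is (globally) exact if there exists $\lambda_0 \ge 0$ such that $F_{\lambda_0}$ attains a global minimum on $A \times P$, and $(x^*, p^* )$ is a global minimizer of $F_{\lambda_0}$ on $A\times P$ iff $p^* = p_0$ and $x^*$ is a globally optimal solution of $(\mathcal{P})$. Local exactness: $F_\lambda$ is exact at a locally optimal solution $x^* \in \operatorname{dom} f$ of $(\mathcal{P})$ if there exists $\lambda_0 \ge 0$ such that $(x^*, p_0)$ is a local minimizer of $F_{\lambda_0}$ on $A \times P$. ''L.s.c. on a set'' means lower semicontinuous at every point of that set. *)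

(* Defs.v *)
From HB Require Import structures.
From mathcomp Require Import all_boot all_order all_algebra.
From mathcomp Require Import all_classical all_reals all_analysis.

Set Implicit Arguments.
Unset Strict Implicit.
Unset Printing Implicit Defensive.

Import Order.TTheory GRing.Theory Num.Theory.
Import numFieldNormedType.Exports.

Local Open Scope classical_set_scope.
Local Open Scope ring_scope.
Local Open Scope ereal_scope.

Definition finite_dimensional (R : realType) (X : lmodType R) : Prop :=
  exists (n : nat) (b : 'I_n -> X),
    forall x : X, exists c : 'I_n -> R, x = (\sum_(i < n) c i *: b i)%R.

(* Semicontinuity is with respect to the whole space T at each point of D, not
   the semicontinuity of the restriction of g to D. *)
Definition lsc_on (R : realType) (T : topologicalType) (D : set T)
    (g : T -> \bar R) : Prop :=
  forall x, D x -> forall a : R, a%:E < g x -> \forall y \near x, a%:E < g y.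

Lemma lsc_on_setT (R : realType) (T : topologicalType) (g : T -> \bar R) :
  lsc_on [set: T] g <-> lower_semicontinuous g.
Proof.
split=> [lscg x a agx|lscg x _ a /lscg[V nV Vg]].
  by exists [set y | a%:E < g y]; [exact: lscg|].
exact: filterS nV.
Qed.

Definition global_minimizer (R : realType) (T : Type) (g : T -> \bar R)
    (S : set T) (x : T) : Prop :=
  S x /\ forall y, S y -> g x <= g y.

Definition local_minimizer (R : realType) (T : topologicalType)
    (g : T -> \bar R) (S : set T) (x : T) : Prop :=
  S x /\ \forall y \near x, S y -> g x <= g y.

Definition edom (R : realType) (T : Type) (g : T -> \bar R) : set T :=
  [set x | `|g x| < +oo].

(* For lambda = 0 the library convention 0 * +oo = 0 applies, so that
   penalty f phi 0 (x, p) = f x even where phi is infinite. *)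
Definition penalty (R : realType) (X P : Type) (f : X -> \bar R)
    (phi : X * P -> \bar R) (lambda : R) (z : X * P) : \bar R :=
  f z.1 + lambda%:E * phi z.

Definition sublevel (R : realType) (X P : Type) (A : set X)
    (phi : X * P -> \bar R) (delta : R) : set (X * P) :=
  [set z | A z.1 /\ phi z < delta%:E].

Definition globally_exact (R : realType) (X P : Type) (M A : set X)
    (f : X -> \bar R) (phi : X * P -> \bar R) (p0 : P) : Prop :=
  exists lambda0 : R, [/\ (0 <= lambda0)%R,
    exists z, global_minimizer (penalty f phi lambda0) (A `*` [set: P]) z &
    forall x p,
      global_minimizer (penalty f phi lambda0) (A `*` [set: P]) (x, p) <->
      p = p0 /\ global_minimizer f (M `&` A) x].

Definition exact_at (R : realType) (X P : topologicalType) (A : set X)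
    (f : X -> \bar R) (phi : X * P -> \bar R) (p0 : P) (x : X) : Prop :=
  exists2 lambda0 : R, (0 <= lambda0)%R &
    local_minimizer (penalty f phi lambda0) (A `*` [set: P]) (x, p0).

(* Main.v *)
(* Once [F_a >= f*] on [A x P] for one [a], the parameter [a + 1] is exact: a
   minimizer with value [f*] must satisfy [phi = 0]. If no such [a] exists, pick
   [z n = (x n, p n)] with [F_n (z n) < f*]. Boundedness below of some
   [F_lambda0] forces [phi (z n)] to tend to 0, so [p n] tends to [p0] by the
   growth condition, and [x n] stays in a compact set, hence has a cluster point
   [x]. Lower semicontinuity of [phi] and [f] makes [x] a global solution, and
   the points [z n] contradict local exactness at [x]. *)
Require Import Defs.
From HB Require Import structures.
From mathcomp Require Import all_boot all_order all_algebra.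
From mathcomp Require Import all_classical all_reals all_analysis.
Set Implicit Arguments.
Unset Strict Implicit.
Unset Printing Implicit Defensive.
Import Order.TTheory GRing.Theory Num.Theory.
Import numFieldNormedType.Exports.
Local Open Scope classical_set_scope.
Local Open Scope ring_scope.
Local Open Scope ereal_scope.

(** * Bounded sets in finite-dimensional normed spaces *)

Lemma findim_free_span (R : realType) (X : lmodType R) :
  finite_dimensional X ->
  exists (n : nat) (b : 'I_n -> X),
    (forall x, exists c : 'rV[R]_n, x = \sum_i c ord0 i *: b i)%R /\
    (forall c : 'rV[R]_n, \sum_i c ord0 i *: b i = 0 -> c = 0)%R.
Proof.
move=> Xfin.
pose spans n := exists b : 'I_n -> X,
  (forall x, exists c : 'rV[R]_n, x = \sum_i c ord0 i *: b i)%R.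
have ex_spans : exists n, `[< spans n >].
  have [n [b bX]] := Xfin; exists n; apply/asboolP; exists b => x.
  have [c ->] := bX x; exists (\row_i c i)%R.
  by apply: eq_bigr => i _; rewrite mxE.
(* A spanning family of minimal size is free. *)
case: (ex_minnP ex_spans) => n /asboolP[b bX] n_min.
exists n, b; split=> // c Tc0; apply: contrapT => /eqP/rV0Pn[i ci_neq0].
case: n => [|n] in b bX n_min c Tc0 i ci_neq0 *; first by case: i {ci_neq0}.
have /n_min : `[< spans n >]; last by rewrite ltnn.
apply/asboolP; exists (b \o lift i) => x; have [d ->] := bX x.
(* Subtracting a multiple of the relation [c] keeps the vector represented and kills coordinate [i],
   so [b \o lift i] still spans with one vector fewer. *)
pose e : 'rV[R]_n.+1 := (d - (d ord0 i / c ord0 i) *: c)%R.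
exists (\row_j e ord0 (lift i j))%R.
have -> : (\sum_j d ord0 j *: b j = \sum_j e ord0 j *: b j)%R.
  transitivity (\sum_j d ord0 j *: b j -
      (d ord0 i / c ord0 i) *: \sum_j c ord0 j *: b j)%R.
    by rewrite Tc0 scaler0 subr0.
  rewrite scaler_sumr -sumrB; apply: eq_bigr => j _.
  by rewrite !mxE scalerA -scalerBl.
rewrite (bigD1_ord i)//= !mxE mulfVK// subrr scale0r add0r.
by apply: eq_bigr => j _; rewrite !mxE.
Qed.

Lemma findim_bounded_compact (R : realType) (X : normedModType R) (S : set X) :
  finite_dimensional X -> bounded_set S -> exists2 K, compact K & S `<=` K.
Proof.
(* The coordinate map [T] is bounded below on the unit sphere, so a bounded set
   is contained in the image under [T] of a closed ball. *)
move=> /findim_free_span[n [b [bX b_free]]] S_bnd.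
pose T (c : 'rV[R]_n) : X := (\sum_i c ord0 i *: b i)%R.
have T_cont : continuous T.
  move=> c; apply: (@cvg_big _ _ +%R 0%R xpredT _ _ (nbhs c)) => [|i _].
    exact: add_continuous.
  by apply: cvgZr_tmp; exact: coord_continuous.
have TZ a c : T (a *: c)%R = (a *: T c)%R.
  rewrite /T scaler_sumr; apply: eq_bigr => i _; rewrite mxE scalerA//.
pose sphere := [set c : 'rV[R]_n | `|c|%R = 1%R].
have [m m_gt0 mT] : exists2 m : R, (0 < m)%R &
    forall c, (m * `|c| <= `|T c|)%R.
  (* Both sides are homogeneous in [c], so unit vectors suffice. *)
  suff [m m_gt0 mT] : exists2 m : R, (0 < m)%R &
      forall c, sphere c -> (m <= `|T c|)%R.
    exists m => // c; have [->|c_neq0] := eqVneq c 0%R.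
      by rewrite normr0 mulr0.
    have c_gt0 : (0 < `|c|)%R by rewrite normr_gt0.
    have := mT (`|c|^-1 *: c)%R; rewrite TZ !normrZ normfV normr_id.
    rewrite -ler_pdivlMr// mulrC; apply.
    by rewrite /sphere/= normrZ normfV normr_id mulVf// gt_eqF.
  (* The sphere is empty in dimension 0, where any positive [m] will do. *)
  have [sphere_neq0|sphere_eq0] := pselect (sphere !=set0); last first.
    by exists 1%R => // c cS; case: sphere_eq0; exists c.
  have sphere_compact : compact sphere.
    apply: bounded_closed_compact.
      by exists 1%R; split=> // r r1 c /= ->; exact: ltW.
    apply: (@preimage_closed _ R (fun c : 'rV[R]_n => `|c|%R) [set 1%R]);
      last exact: closed_eq.
    by move=> c _; exact: norm_continuous.
  have [|c] :=
      compact_EVT_min (f := fun c => `|T c|%R) sphere_neq0 sphere_compact.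
    apply: continuous_subspaceT => c.
    by apply: continuous_comp; [exact: T_cont|exact: norm_continuous].
  (* [m] is the minimum of [|T c|] on the sphere; were it zero, freeness would force [c = 0], which
     has norm 0. *)
  rewrite inE /sphere/= => c1 c_min; exists `|T c|%R; last first.
    by move=> d dS; apply: c_min; rewrite inE.
  rewrite normr_gt0; apply/eqP => /b_free c0.
  by move: c1; rewrite c0 normr0 => /esym/eqP; rewrite oner_eq0.
have [M SM] : exists M : R, forall x, S x -> (`|x| <= M)%R.
  have [M [_ SM]] := S_bnd; exists (M + 1)%R => x Sx.
  by apply: (SM _ _ x Sx); rewrite ltrDl.
exists (T @` [set c | (`|c| <= M / m)%R]).
  apply: continuous_compact; first exact: continuous_subspaceT.
  apply: bounded_closed_compact.
    exists (M / m)%R; split=> [|r r_gt c /= cM]; first exact: num_real.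
    exact: ltW (le_lt_trans cM r_gt).
  apply: (@preimage_closed _ R (fun c : 'rV[R]_n => `|c|%R)
    [set r | (r <= M / m)%R]); last exact: closed_le.
  by move=> c _; exact: norm_continuous.
move=> x Sx; have [c x_eq] := bX x; exists c => //=.
by rewrite ler_pdivlMr// mulrC (le_trans (mT c))// /T -x_eq SM.
Qed.

(** * Dependence of the penalty function on its parameter *)

Section penalty.
Context {R : realType} {X P : Type} (f : X -> \bar R) (phi : X * P -> \bar R).
Hypothesis phi_ge0 : forall z, 0 <= phi z.

Lemma le_penalty (a b : R) z :
  (a <= b)%R -> penalty f phi a z <= penalty f phi b z.
Proof. by move=> ab; rewrite leeD2l// lee_wpmul2r// lee_fin. Qed.

(** Distributivity survives [phi z = +oo] because both parameters are nonnegative. The surplus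
    [b%:E * phi z] is what later forces [phi] to be small. *)
Lemma penaltyD (a b : R) z : (0 <= a)%R -> (0 <= b)%R ->
  penalty f phi (a + b) z = penalty f phi a z + b%:E * phi z.
Proof.
by move=> a0 b0; rewrite /penalty -addeA -ge0_muleDl ?lee_fin// EFinD.
Qed.

Lemma le_f_penalty (a : R) z : (0 <= a)%R -> f z.1 <= penalty f phi a z.
Proof. by move=> a0; rewrite leeDl// mule_ge0// lee_fin. Qed.

End penalty.

(** * Exactness and the lower bound [fstar] *)

Section exactness.
Context {R : realType} {X : normedModType R} {P : metricType R}
  (M A : set X) (f : X -> \bar R) (fstar : R) (phi : X * P -> \bar R) (p0 : P).
Hypothesis fstar_min : exists2 x, global_minimizer f (M `&` A) x & f x = fstar%:E.
Hypothesis phi_ge0 : forall z, 0 <= phi z.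
Hypothesis phi_eq0 : forall x p, phi (x, p) = 0 <-> p = p0 /\ M x.

Lemma penalty_feasible (a : R) x : M x -> penalty f phi a (x, p0) = f x.
Proof.
by move=> Mx; rewrite /penalty (phi_eq0 x p0).2//= mule0 adde0.
Qed.

Lemma global_minimizer_fstar x :
  global_minimizer f (M `&` A) x <-> (M `&` A) x /\ f x <= fstar%:E.
Proof.
have [y [Oy y_min] fy] := fstar_min.
split=> [[Ox x_min]|[Ox fx]]; first by split; rewrite // -fy x_min.
by split=> // z Oz; rewrite (le_trans fx)// -fy y_min.
Qed.

Lemma globally_exact_ge (a : R) : (0 <= a)%R ->
  (forall z, (A `*` [set: P]) z -> fstar%:E <= penalty f phi a z) ->
  globally_exact M A f phi p0.
Proof.
move=> a_ge0 a_lb; have a1_ge0 : (0 <= a + 1)%R by rewrite addr_ge0.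
have minP x : global_minimizer f (M `&` A) x ->
    global_minimizer (penalty f phi (a + 1)) (A `*` [set: P]) (x, p0).
  move=> /global_minimizer_fstar[[Mx Ax] fx]; split=> // z Az.
  rewrite penalty_feasible// (le_trans fx)// (le_trans (a_lb z Az))//.
  by rewrite le_penalty// lerDl.
have [xs xs_min fxs] := fstar_min; exists (a + 1)%R; split=> //.
  by exists (xs, p0); exact: minP.
move=> x p; split=> [[[/= Ax _] xp_min]|[-> /minP]//].
have le_fstar : penalty f phi (a + 1) (x, p) <= fstar%:E.
  have [[Mxs Axs] _] := xs_min.
  by rewrite -fxs -(penalty_feasible (a + 1) Mxs); apply: xp_min.
have phi0 : phi (x, p) = 0.
  apply/eqP; rewrite eq_le phi_ge0 andbT.
  move: le_fstar; rewrite penaltyD// mul1e => le_fstar.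
  (* [fstar + phi <= F_a + phi = F_(a+1) <= fstar] at [(x, p)]; cancelling the finite [fstar] leaves
     [phi <= 0]. *)
  have := le_trans (leeD2r (phi (x, p)) (a_lb (x, p) (conj Ax I))) le_fstar.
  by rewrite -[leRHS]adde0 leeD2lE.
have [pp0 Mx] := (phi_eq0 x p).1 phi0; split=> //.
apply/global_minimizer_fstar; split=> //.
by rewrite (le_trans _ le_fstar)//; exact: (@le_f_penalty _ _ _ _ _ _ _ (x, p)).
Qed.

(** The single exact parameter serves both claims: a global minimizer of the penalty is a local one,
    and its value [fstar] is a lower bound. *)
Lemma globally_exact_local_bounded : globally_exact M A f phi p0 ->
  (forall x, global_minimizer f (M `&` A) x -> exact_at A f phi p0 x) /\
  (exists2 a : R, (0 <= a)%R &
     exists c : R, forall z, (A `*` [set: P]) z -> c%:E <= penalty f phi a z).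
Proof.
move=> [a [a_ge0 _ minP]]; split=> [x x_min|].
  have [Axp xp_min] := (minP x p0).2 (conj erefl x_min).
  exists a => //; split=> //.
  by near=> z; exact: xp_min.
have [x x_min fx] := fstar_min; have [[Mx Ax] _] := x_min.
exists a => //; exists fstar => z Az.
rewrite -fx -(penalty_feasible a Mx).
by have [_] := (minP x p0).2 (conj erefl x_min); exact.
Unshelve. all: by end_near.
Qed.

(* The assumption on [K] is the common weakening of the two boundedness
   hypotheses: hypothesis (1) yields [mu = 0], hypothesis (2) any [delta]. *)
Lemma penalty_ge_fstar (omega : R -> R) (lambda0 c mu : R) (K : set X) :
  closed A -> lsc_on (M `&` A) f -> lsc_on (A `*` [set p0]) phi ->
  (forall t : R, (0 <= t)%R -> (0 <= omega t)%R) ->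
  (forall s t : R, (0 <= s)%R -> (s <= t)%R -> (omega s <= omega t)%R) ->
  (forall t : R, (0 <= t)%R -> (omega t = 0%R <-> t = 0%R)) ->
  (forall x p, A x -> (omega (mdist p p0))%:E <= phi (x, p)) ->
  (forall x, global_minimizer f (M `&` A) x -> exact_at A f phi p0 x) ->
  (0 <= lambda0)%R ->
  (forall z, (A `*` [set: P]) z -> c%:E <= penalty f phi lambda0 z) ->
  (exists2 delta : R, (0 < delta)%R &
    forall z, A z.1 -> phi z < delta%:E -> penalty f phi mu z < fstar%:E ->
    K z.1) ->
  compact K ->
  exists2 a : R, (0 <= a)%R &
    forall z, (A `*` [set: P]) z -> fstar%:E <= penalty f phi a z.
Proof.
move=> A_closed f_lsc phi_lsc omega_ge0 omega_mono omega_eq0 phi_growth.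
move=> exact_opt lambda0_ge0 c_lb [delta delta_gt0 zK] K_compact.
apply: contrapT => no_a.
have viol (n : nat) :
    exists z, (A `*` [set: P]) z /\ penalty f phi n%:R z < fstar%:E.
  apply: contrapT => no_z; apply: no_a; exists n%:R => // z Az.
  by rewrite leNgt; apply/negP => ltz; apply: no_z; exists z.
have [z /all_and2[Az z_lt]] := choice viol.
have penalty_z_lt (a : R) : \forall n \near \oo, penalty f phi a (z n) < fstar%:E.
  near=> n; rewrite (le_lt_trans _ (z_lt n))// le_penalty//.
  by near: n; exact: nbhs_infty_ger.
have phi_z_lt (a : R) : (0 < a)%R -> \forall n \near \oo, phi (z n) < a%:E.
  (* With this [b], a point with [phi >= a] would have [F_(lambda0+b) >= c + b * a = c + |fstar - c|
     >= fstar], which eventually fails along [z]. *)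
  move=> a_gt0; pose b := (`|fstar - c| / a)%R.
  have b_ge0 : (0 <= b)%R by rewrite divr_ge0// ltW.
  apply: filterS (penalty_z_lt (lambda0 + b)%R) => n.
  rewrite penaltyD// ltNge => /negP nle; rewrite ltNge; apply/negP => a_le.
  apply: nle; apply: le_trans (leeD (c_lb _ (Az n)) (lee_wpmul2l _ a_le)).
    by rewrite -EFinM -EFinD lee_fin /b divfK ?gt_eqF// -lerBlDl ler_norm.
  by rewrite lee_fin.
have p_near (U : set P) : nbhs p0 U -> \forall n \near \oo, U (z n).2.
  move=> /metricType_numDomainType.nbhs_mdistP[e /= e_gt0 eU].
  have omega_e_gt0 : (0 < omega e)%R.
    rewrite lt_neqAle omega_ge0 ?ltW// andbT eq_sym; apply/eqP.
    by move/(omega_eq0 e (ltW e_gt0)).1 => e0; rewrite e0 ltxx in e_gt0.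
  apply: filterS (phi_z_lt _ omega_e_gt0) => n phi_lt; apply: eU => /=.
  (* A distance of at least [e] would give [omega e <= phi (z n)] by monotonicity and growth. *)
  rewrite metric_sym ltNge; apply/negP => /(omega_mono _ _ (ltW e_gt0)) le_omega.
  have := le_lt_trans (phi_growth _ (z n).2 (Az n).1).
  by rewrite -surjective_pairing => /(_ _ phi_lt); rewrite lte_fin ltNge le_omega.
have [x [_ x_cluster]] : K `&` cluster ((z n).1 @[n --> \oo]) !=set0.
  apply: K_compact; apply: filterS2 (phi_z_lt _ delta_gt0) (penalty_z_lt mu) => n.
  by apply: zK; exact: (Az n).1.
(* No subsequence is extracted: since [(z n).2] converges to [p0], clustering of [(z n).1] at [x]
   makes [z n] visit each neighborhood of [(x, p0)] at some index where a given eventual property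
   also holds. *)
have frequently (U : set (X * P)) (E : set nat) :
    nbhs (x, p0) U -> (\forall n \near \oo, E n) -> exists n, U (z n) /\ E n.
  move=> [[V W] /= [xV p0W] VWU] oo_E.
  have EW_oo : \forall n \near \oo, E n /\ W (z n).2.
    by apply: filterI => //; exact: p_near.
  have [|_ [[n [En Wn] <-] Vn]] :=
      x_cluster ((fun n => (z n).1) @` [set n | E n /\ W (z n).2]) V _ xV.
    by apply: filterS EW_oo => n; exists n.
  by exists n; split=> //; apply: VWU; split.
have Ax : A x.
  apply: A_closed => V xV.
  have [|n [Vn _]] := frequently (fst @^-1` V) setT _ filterT.
    exact: cvg_fst.
  by exists (z n).1; split=> //; exact: (Az n).1.
have Mx : M x.
  suff /(phi_eq0 x p0).1[] : phi (x, p0) = 0 by [].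
  apply/eqP; rewrite eq_le phi_ge0 andbT leNgt; apply/negP => phi_gt0.
  have [a a_gt0 a_lt] : exists2 a : R, (0 < a)%R & a%:E < phi (x, p0).
    case: (phi (x, p0)) phi_gt0 => [r|_|//]; last by exists 1%R; rewrite ?ltry.
    rewrite lte_fin => r_gt0; exists (r / 2)%R; first exact: divr_gt0.
    by rewrite lte_fin gtr_pMr// invf_lt1// ltr1n.
  (* Lower semicontinuity keeps [phi] above [a] near [(x, p0)], while [phi (z n) < a] eventually. *)
  have [n []] := frequently _ _ (phi_lsc (x, p0) (conj Ax erefl) a a_lt)
    (phi_z_lt a a_gt0).
  by move=> /ltW; rewrite leNgt => /negP.
have fx : f x <= fstar%:E.
  rewrite leNgt; apply/negP => /(f_lsc x (conj Mx Ax)) f_gt.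
  have [|n [fstar_lt _]] :=
      frequently (fst @^-1` [set y | fstar%:E < f y]) setT _ filterT.
    exact: cvg_fst.
  (* The penalty term is nonnegative, so [f (z n).1 <= F_n (z n) < fstar]. *)
  have := le_lt_trans (le_f_penalty f phi_ge0 (z n) (ler0n R n)) (z_lt n).
  move=> /(lt_trans fstar_lt).
  by rewrite ltxx.
have [a a_ge0 [_ x_min]] :=
  exact_opt x ((global_minimizer_fstar x).2 (conj (conj Mx Ax) fx)).
(* Some [z n] lies where [(x, p0)] is minimal for [F_a] and also has [F_a (z n) < fstar]; then
   [f x < fstar] although [x] is feasible. *)
have [n [/(_ (Az n)) + lt_fstar]] := frequently _ _ x_min (penalty_z_lt a).
rewrite penalty_feasible// => fx_le.
have [y [Oy y_min] fy] := fstar_min.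
have := le_lt_trans (le_trans (y_min x (conj Mx Ax)) fx_le) lt_fstar.
by rewrite fy ltxx.
Unshelve. all: by end_near.
Qed.

End exactness.

Theorem theorem3p7 (R : realType) (X : normedModType R) (P : metricType R)
    (M A : set X) (f : X -> \bar R) (fstar : R)
    (phi : X * P -> \bar R) (p0 : P)
    (X_findim : finite_dimensional X)
    (M_neq0 : M !=set0) (A_neq0 : A !=set0)
    (f_gtNy : forall x, -oo < f x)
    (domf_neq0 : edom f !=set0)
    (fstar_min : exists2 x, global_minimizer f (M `&` A) x & f x = fstar%:E)
    (phi_ge0 : forall z, 0 <= phi z)
    (phi_eq0 : forall x p, phi (x, p) = 0 <-> p = p0 /\ M x)
    (A_closed : closed A)
    (f_lsc : lsc_on (M `&` A) f)
    (phi_lsc : lsc_on (A `*` [set p0]) phi)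
    (phi_growth : exists omega : R -> R,
      [/\ forall t : R, (0 <= t)%R -> (0 <= omega t)%R,
          forall s t : R, (0 <= s)%R -> (s <= t)%R -> (omega s <= omega t)%R,
          forall t : R, (0 <= t)%R -> (omega t = 0%R <-> t = 0%R) &
          forall x p, A x -> (omega (mdist p p0))%:E <= phi (x, p)])
    (bounded_hyp :
      (exists2 delta : R, (0 < delta)%R &
         bounded_set (fst @` sublevel A phi delta)) \/
      (exists2 mu : R, (0 < mu)%R &
         bounded_set [set x | A x /\
           ereal_inf (range (fun p => penalty f phi mu (x, p))) < fstar%:E])) :
  globally_exact M A f phi p0 <->
  (forall x, global_minimizer f (M `&` A) x -> exact_at A f phi p0 x) /\
  (exists2 lambda0 : R, (0 <= lambda0)%R &
     exists c : R, forall z, (A `*` [set: P]) z ->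
       c%:E <= penalty f phi lambda0 z).
Proof.
split; first exact: globally_exact_local_bounded fstar_min phi_eq0.
move=> [exact_opt [lambda0 lambda0_ge0 [c c_lb]]].
have [omega [omega_ge0 omega_mono omega_eq0 omega_le]] := phi_growth.
have [mu [K K_compact zK]] : exists (mu : R), exists2 K : set X, compact K &
    exists2 delta : R, (0 < delta)%R &
    forall z, A z.1 -> phi z < delta%:E -> penalty f phi mu z < fstar%:E -> K z.1.
  case: bounded_hyp => [[delta delta_gt0]|[mu mu_gt0]].
  - move=> /(findim_bounded_compact X_findim)[K K_compact subK].
    exists 0%R, K => //; exists delta => // z Az z_lt _.
    by apply: subK; exists z.
  - move=> /(findim_bounded_compact X_findim)[K K_compact subK].
    exists mu, K => //; exists 1%R => // z Az _ z_lt; apply: subK; split=> //.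
    (* The infimum over [p] is at most the value at [z.2]. *)
    apply: le_lt_trans z_lt; apply: ereal_inf_lbound; exists z.2 => //.
    by rewrite -surjective_pairing.
have [a a_ge0 a_lb] := penalty_ge_fstar fstar_min phi_ge0 phi_eq0 A_closed f_lsc
  phi_lsc omega_ge0 omega_mono omega_eq0 omega_le exact_opt lambda0_ge0 c_lb zK
  K_compact.
exact: (globally_exact_ge fstar_min phi_ge0 phi_eq0 a_ge0 a_lb).
Qed.
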